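(* Let $\alpha:R\to R'$ be a Jordan homomorphism and let $R''$ be the subring of $R'$ generated by $R^\alpha$. Then: (a) the mapping $\alpha_{PE}:PE_2(R)\to PE_2(R'')$, $H\cdot E(T)\mapsto H''\cdot E(T^\alpha)$ (for finite sequences $T$ in $R$) is a well defined homomorphism of groups; (b) the mapping $\overline\alpha:C\to C''$, $R(1,0)\cdot E(T)\mapsto R'(1',0')\cdot E(T^\alpha)$ (for finite sequences $T$ in $R$) is well defined; (c) $(\alpha_{PE},\overline\alpha)$ is a homomorphism of transformation groups, i.e. $(p\cdot E(T))^{\overline\alpha}=p^{\overline\alpha}\cdot E(T^\alpha)$ for all $p\in C$ and all finite sequences $T$ in $R$.
   Context: Rings are associative with $1$. A Jordan homomorphism $\alpha:R\to R'$ satisfies $(a+b)^\alpha=a^\alpha+b^\alpha$, $1^\alpha=1'$, $(aba)^\alpha=a^\alpha b^\alpha a^\alpha$. For $t$ in a ring, $E(t):=\begin{pmatrix} t&1\\-1&0\end{pmatrix}$; for $T=(t_1,\ldots,t_n)$, $E(T):=E(t_1)\cdots E(t_n)$ ($=I$ if $n=0$), $T^\alpha:=(t_1^\alpha,\ldots,t_n^\alpha)$. $E_2(R)\leq GL_2(R)$ is generated by all $E(t)$; $H$ is its centre, $PE_2(R):=E_2(R)/H$, and similarly $H''$, $PE_2(R'')$ for $R''$. The projective line $\mathbb{P}(R)$ is the set of submodules $R(a,b)\leq R^2$ with $(a,b)$ the first row of an invertible matrix, with right action $R(a,b)\cdot M=R((a,b)M)$ of $GL_2(R)$. Points $R(a,b),R(c,d)$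 are distant if $\{(a,b),(c,d)\}$ is a basis of $R^2$. $C$ is the connected component of $R(1,0)$ in the distant graph of $\mathbb{P}(R)$ (equal to the $E_2(R)$-orbit of $R(1,0)$). $\mathbb{P}(R'')$ is identified with a subset of $\mathbb{P}(R')$ via $R''(a,b)\mapsto R'(a,b)$, and $C''$ is the connected component of $R''(1',0')$ in $\mathbb{P}(R'')$ (the $E_2(R'')$-orbit of this point). $PE_2(R)$ and $PE_2(R'')$ act on $C$ and $C''$ respectively. *)

(* Defs.v *)
(* Rings are associative with 1 (pzRingType: possibly 0 = 1,
   not necessarily commutative). *)
From HB Require Import structures.
From mathcomp Require Import all_boot all_order all_algebra.
Set Implicit Arguments. Unset Strict Implicit. Unset Printing Implicit Defensive.
Import GRing.Theory.
Local Open Scope ring_scope.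

Section Defs.
Variable R : pzRingType.

Definition Emx (t : R) : 'M[R]_2 :=
  \matrix_(i < 2, j < 2)
    if i == 0 then (if j == 0 then t else 1) else (if j == 0 then -1 else 0).

Definition EmxS (T : seq R) : 'M[R]_2 := foldr (fun t M => Emx t *m M) 1%:M T.

(* The subgroup of GL_2(R) generated by the E(t) with t in S
   (S = all of R gives E_2(R); S = R'' gives E_2(R'') inside 'M[R']_2). *)
Inductive E2 (S : R -> Prop) : 'M[R]_2 -> Prop :=
  | E2_gen t : S t -> E2 S (Emx t)
  | E2_one : E2 S 1%:M
  | E2_mul M N : E2 S M -> E2 S N -> E2 S (M *m N)
  | E2_inv M N : E2 S M -> M *m N = 1%:M -> N *m M = 1%:M -> E2 S N.

Definition E2centre (S : R -> Prop) (M : 'M[R]_2) : Prop :=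
  E2 S M /\ forall N, E2 S N -> M *m N = N *m M.

(* the cyclic left submodule R v of R^2 (row vectors), i.e. the point R(a,b) *)
Definition rspan (v : 'rV[R]_2) : 'rV[R]_2 -> Prop := fun w => exists r, w = r *: v.

Definition pact (P : 'rV[R]_2 -> Prop) (M : 'M[R]_2) : 'rV[R]_2 -> Prop :=
  fun w => exists u, P u /\ w = u *m M.

Definition peq (P Q : 'rV[R]_2 -> Prop) : Prop := forall w, P w <-> Q w.

Definition pt10 : 'rV[R]_2 -> Prop := rspan (delta_mx 0 0).

Definition inC (S : R -> Prop) (p : 'rV[R]_2 -> Prop) : Prop :=
  exists g, E2 S g /\ peq p (pact pt10 g).
End Defs.

Definition jordan_hom (R R' : pzRingType) (alpha : R -> R') : Prop :=
  (forall a b, alpha (a + b) = alpha a + alpha b) /\ alpha 1 = 1 /\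
  (forall a b, alpha (a * b * a) = alpha a * alpha b * alpha a).

Definition subring_closed_pred (R' : pzRingType) (P : R' -> Prop) : Prop :=
  P 1 /\ (forall x y, P x -> P y -> P (x - y)) /\ (forall x y, P x -> P y -> P (x * y)).

Definition gen_subring (R R' : pzRingType) (alpha : R -> R') (x : R') : Prop :=
  forall P : R' -> Prop, subring_closed_pred P -> (forall a, P (alpha a)) -> P x.

(* Main.v *)
(* Everything reduces to the stabilizer of R(1,0): if E(T) = (a b; c d) with b = 0 and y a = 1,
   then E(T^alpha) has the same shape. Let E(T)^* be the reversed product of the transposes
   E(t_n)^T ... E(t_1)^T, and f its (1,1) entry. For suitable X, the diagonal entries of
   E(T) X E(T)^* and E(T)^* X E(T) are Jordan polynomials in T and X although the off-diagonal
   ones are not; in particular alpha carries b f and f p a (p in R) to the corresponding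
   expressions over R'. The symplectic relation E(T)^* E(0) E(T) = E(0) yields f d = 1, so with
   p = d y one has f p a = 1 and b f = 0. Hence f' p' a' = 1 and b' f' = 0, so b' = 0.
   Applied to the conjugates E(t) E(T) E(t)^-1 of a central E(T), this shows that E(T^alpha) is
   a scalar matrix commuting with R^alpha. *)
Require Import Defs.
From mathcomp Require Import all_boot all_order all_algebra.
Set Implicit Arguments. Unset Strict Implicit. Unset Printing Implicit Defensive.
Import GRing.Theory.
Local Open Scope ring_scope.

(** * Words in the matrices E(t) and their action on R(1,0) *)

Section Matrices2.
Variable R : pzRingType.
Implicit Types (A B X : 'M[R]_2) (t : R) (T : seq R).

Lemma mulmx2E {m} (A : 'M[R]_(m, 2)) B i j :
  (A *m B) i j = A i 0 * B 0 j + A i 1 * B 1 j.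
Proof.
rewrite mxE !big_ord_recl big_ord0 addr0.
by rewrite (_ : lift ord0 ord0 = 1) //; apply/val_inj.
Qed.

Lemma ord2P (P : 'I_2 -> Prop) : P 0 -> P 1 -> forall i, P i.
Proof.
by move=> P0 P1 [[|[|//]] lti];
  [rewrite (_ : Ordinal lti = 0) | rewrite (_ : Ordinal lti = 1)] => //;
  apply/val_inj.
Qed.

Lemma matrix2P A B :
  A 0 0 = B 0 0 -> A 0 1 = B 0 1 -> A 1 0 = B 1 0 -> A 1 1 = B 1 1 -> A = B.
Proof.
by move=> *; apply/matrixP; apply: ord2P; apply: ord2P.
Qed.

Lemma EmxE t :
  (Emx t 0 0 = t) * (Emx t 0 1 = 1) * (Emx t 1 0 = -1) * (Emx t 1 1 = 0).
Proof. by rewrite !mxE. Qed.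

Lemma mx1E : ((1%:M : 'M[R]_2) 0 0 = 1) * ((1%:M : 'M[R]_2) 0 1 = 0) *
  ((1%:M : 'M[R]_2) 1 0 = 0) * ((1%:M : 'M[R]_2) 1 1 = 1).
Proof. by rewrite !mxE. Qed.

Lemma trEmx t : (Emx t)^T = - Emx (- t).
Proof. by apply: matrix2P; rewrite !mxE /= ?opprK ?oppr0. Qed.

Lemma EmxS_cat T1 T2 : EmxS (T1 ++ T2) = EmxS T1 *m EmxS T2.
Proof. by elim: T1 => [|t T1 IH] /=; rewrite ?mul1mx // IH mulmxA. Qed.

(** E(t)^-1 = E(0) E(-t) E(0), so the inverse of a word is again a word, formed in a way that
    commutes with additive maps. *)
Fixpoint Einv_word T : seq R :=
  if T is t :: T' then Einv_word T' ++ [:: 0; - t; 0] else [::].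

Lemma EmxS_inv1 t :
  (EmxS [:: 0; - t; 0] 0 0 = 0) * (EmxS [:: 0; - t; 0] 0 1 = -1) *
  (EmxS [:: 0; - t; 0] 1 0 = 1) * (EmxS [:: 0; - t; 0] 1 1 = t).
Proof.
rewrite /EmxS /= !(mulmx2E, EmxE, mx1E).
by rewrite !(mul0r, mulr0, mul1r, mulr1, add0r, addr0, mulNr, mulrN, oppr0, opprK).
Qed.

Lemma Emx_mulV t : Emx t *m EmxS [:: 0; - t; 0] = 1%:M.
Proof.
apply: matrix2P; rewrite mulmx2E !EmxS_inv1 !EmxE !mx1E;
by rewrite !(mul0r, mulr0, mul1r, mulr1, add0r, addr0, mulNr, mulrN, oppr0, opprK, addNr).
Qed.

Lemma Emx_mulVl t : EmxS [:: 0; - t; 0] *m Emx t = 1%:M.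
Proof.
apply: matrix2P; rewrite mulmx2E !EmxS_inv1 !EmxE !mx1E;
by rewrite !(mul0r, mulr0, mul1r, mulr1, add0r, addr0, mulNr, mulrN, oppr0, opprK, subrr).
Qed.

Lemma EmxS_mulV T : EmxS T *m EmxS (Einv_word T) = 1%:M.
Proof.
elim: T => [|t T IH]; first by rewrite mulmx1.
by rewrite [LHS]/= EmxS_cat -mulmxA [X in _ *m X]mulmxA IH mul1mx Emx_mulV.
Qed.

Lemma EmxS_mulVl T : EmxS (Einv_word T) *m EmxS T = 1%:M.
Proof.
elim: T => [|t T IH]; first by rewrite mulmx1.
rewrite [EmxS (t :: T)]/= EmxS_cat -mulmxA [X in _ *m X]mulmxA Emx_mulVl.
by rewrite mul1mx IH.
Qed.

(** The matrix E(T)^*. It may differ from [(EmxS T)^T], as transposition need not reverse products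
    over a noncommutative ring. *)
Fixpoint trEmxS T : 'M[R]_2 := if T is t :: T' then trEmxS T' *m (Emx t)^T else 1%:M.

Lemma trEmxS_rcons T t : trEmxS (rcons T t) = (Emx t)^T *m trEmxS T.
Proof. by elim: T => [|s T IH] /=; rewrite ?mulmx1 ?mul1mx // IH mulmxA. Qed.

(** [Emx 0] is the standard alternating form; each single [Emx t] preserves it, and the product
    collapses from the inside. *)
Lemma trEmxS_symplectic T : trEmxS T *m Emx 0 *m EmxS T = Emx 0.
Proof.
elim: T => [|t T IH]; first by rewrite /= mul1mx mulmx1.
rewrite /= !mulmxA -(mulmxA (trEmxS T)) -(mulmxA (trEmxS T)).
suff -> : (Emx t)^T *m Emx 0 *m Emx t = Emx 0 by [].
apply: matrix2P; rewrite !(mulmx2E, EmxE) !mxE /=;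
by rewrite !(mul0r, mulr0, mul1r, mulr1, add0r, addr0, mulNr, mulrN, oppr0, opprK, subrr, addNr).
Qed.

Lemma E2_EmxS (S : R -> Prop) T : (forall t, t \in T -> S t) -> E2 S (EmxS T).
Proof.
elim: T => [|t T IH] ST; first exact: E2_one.
apply: E2_mul; first by apply/E2_gen/ST; rewrite mem_head.
by apply: IH => s sT; apply: ST; rewrite inE sT orbT.
Qed.

Lemma E2_word (S : R -> Prop) M : E2 S M -> exists T, M = EmxS T.
Proof.
elim=> [t _||A B _ [TA ->] _ [TB ->]|A B _ [T ->] AB BA].
- by exists [:: t]; rewrite /= mulmx1.
- by exists [::].
- by exists (TA ++ TB); rewrite EmxS_cat.
- by exists (Einv_word T); rewrite -[LHS]mulmx1 -(EmxS_mulV T) mulmxA BA mul1mx.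
Qed.

Lemma E2_commute (S : R -> Prop) M :
  (forall t, S t -> M *m Emx t = Emx t *m M) ->
  forall N, E2 S N -> M *m N = N *m M.
Proof.
move=> cM N; elim=> [//||A B _ cA _ cB|A B _ cA AB BA].
- by rewrite mulmx1 mul1mx.
- by rewrite mulmxA cA -mulmxA cB mulmxA.
- by rewrite -[LHS]mul1mx -BA -!mulmxA [A *m _]mulmxA -cA -mulmxA AB mulmx1.
Qed.

(** The first row (a, b) of [A] spans R(1,0) exactly when b = 0 and R a = R. *)
Definition fixes_pt10 A := A 0 1 = 0 /\ exists y, y * A 0 0 = 1.

Lemma pact_pt10P A (w : 'rV[R]_2) : pact (@pt10 R) A w <-> exists r, w = r *: row 0 A.
Proof.
split=> [[u [[r ->] ->]]|[r ->]]; first by exists r; rewrite -scalemxAl -rowE.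
exists (r *: delta_mx 0 0); split; first by exists r.
by rewrite -scalemxAl -rowE.
Qed.

Lemma pact_comp (P : 'rV[R]_2 -> Prop) A B : peq (pact P (A *m B)) (pact (pact P A) B).
Proof.
move=> w; split=> [[u [Pu ->]]|[_ [[u [Pu ->]] ->]]].
  by exists (u *m A); rewrite mulmxA; split=> //; exists u.
by exists u; rewrite mulmxA.
Qed.

Lemma pact_pt10_eqP A B C : C *m B = 1%:M -> B *m C = 1%:M ->
  peq (pact (@pt10 R) A) (pact (@pt10 R) B) <-> fixes_pt10 (A *m C).
Proof.
move=> CB BC; split=> [eqAB|[AC01 [y yA]]].
  have /pact_pt10P[r rA] : pact (@pt10 R) B (row 0 A).
    by apply/eqAB/pact_pt10P; exists 1; rewrite scale1r.
  have /pact_pt10P[s sB] : pact (@pt10 R) A (row 0 B).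
    by apply/eqAB/pact_pt10P; exists 1; rewrite scale1r.
  have rAC : row 0 (A *m C) = r *: row 0 1%:M.
    by rewrite row_mul rA -scalemxAl -row_mul BC.
  have sAC : row 0 1%:M = s *: row 0 (A *m C).
    by rewrite row_mul scalemxAl -sB -row_mul BC.
  split; first by move/rowP/(_ 1): rAC; rewrite !mxE /= mulr0.
  by exists s; move/rowP/(_ 0): sAC; rewrite [RHS]mxE ![row _ _ _ _]mxE mx1E => ->.
have rAC : row 0 (A *m C) = (A *m C) 0 0 *: row 0 1%:M.
  apply/rowP; apply: ord2P; rewrite [RHS]mxE ![row _ _ _ _]mxE mx1E ?mulr1 //.
  by rewrite mulr0.
have rA : row 0 A = (A *m C) 0 0 *: row 0 B.
  by rewrite -[A in LHS]mulmx1 -CB mulmxA row_mul rAC -scalemxAl -row_mul mul1mx.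
have sB : row 0 B = y *: row 0 A by rewrite rA scalerA yA scale1r.
move=> w; split=> /pact_pt10P[r ->]; apply/pact_pt10P.
  by exists (r * (A *m C) 0 0); rewrite -scalerA -rA.
by exists (r * y); rewrite -scalerA -sB.
Qed.

End Matrices2.

(** * Jordan homomorphisms applied to words *)

Section JordanHom.
Variables (R R' : pzRingType) (alpha : R -> R').
Hypothesis alphaJ : jordan_hom alpha.

Lemma jordanD a b : alpha (a + b) = alpha a + alpha b.
Proof. by case: alphaJ. Qed.

Lemma jordan1 : alpha 1 = 1.
Proof. by case: alphaJ => _ []. Qed.

Lemma jordanU a b : alpha (a * b * a) = alpha a * alpha b * alpha a.
Proof. by case: alphaJ => _ []. Qed.

Lemma jordan0 : alpha 0 = 0.
Proof. by apply: (addrI (alpha 0)); rewrite -jordanD !addr0. Qed.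

Lemma jordanN a : alpha (- a) = - alpha a.
Proof. by apply: (addrI (alpha a)); rewrite -jordanD !subrr jordan0. Qed.

(** Linearization of [jordanU] at [a + c]. *)
Lemma jordan_triple a b c :
  alpha (a * b * c + c * b * a) =
  alpha a * alpha b * alpha c + alpha c * alpha b * alpha a.
Proof.
have := jordanU (a + c) b.
rewrite !jordanD !mulrDl !mulrDr !jordanD !jordanU !addrA.
by move/addIr; rewrite -!addrA => /addrI.
Qed.

Lemma jordan_inv_word T : Einv_word (map alpha T) = map alpha (Einv_word T).
Proof. by elim: T => //= t T ->; rewrite map_cat /= jordan0 jordanN. Qed.

(* The two conditions on the off-diagonal entries (u, v), namely that alpha respects su + vs and
   us + sv, are exchanged, up to Jordan triple products, by the congruence X |-> E(t) X E(t)^T. *)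
Definition jordan_related (X : 'M[R]_2) (X' : 'M[R']_2) : Prop :=
  [/\ X' 0 0 = alpha (X 0 0), X' 1 1 = alpha (X 1 1),
      forall s, alpha (s * X 0 1 + X 1 0 * s) = alpha s * X' 0 1 + X' 1 0 * alpha s
    & forall s, alpha (X 0 1 * s + s * X 1 0) = X' 0 1 * alpha s + alpha s * X' 1 0].

Lemma jordan_related_Emx t X X' : jordan_related X X' ->
  jordan_related (Emx t *m X *m (Emx t)^T) (Emx (alpha t) *m X' *m (Emx (alpha t))^T).
Proof.
have E (Q : pzRingType) (r : Q) (Y : 'M[Q]_2) (Z := Emx r *m Y *m (Emx r)^T) :
    (Z 0 0 = r * Y 0 0 * r + (r * Y 0 1 + Y 1 0 * r) + Y 1 1) *
    (Z 0 1 = - (r * Y 0 0 + Y 1 0)) * (Z 1 0 = - (Y 0 0 * r + Y 0 1)) *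
    (Z 1 1 = Y 0 0).
  rewrite /Z !mulmx2E ![(Emx r)^T _ _]mxE !EmxE.
  rewrite !(mul0r, mulr0, mul1r, mulr1, addr0, mulNr, mulrN, opprK) mulrDl -opprD.
  by rewrite -!addrA [r * _ + (_ * r + _)]addrCA !addrA.
move=> [X00 X11 X01 X10]; split; rewrite !E.
- by rewrite !jordanD jordanU X00 X11 -jordanD X01.
- by [].
- move=> s; rewrite mulrN mulNr -opprD jordanN mulrN mulNr -opprD; congr (- _).
  rewrite !mulrDr !mulrDl !mulrA X00 addrACA [X in _ + X]addrC jordanD jordan_triple X10.
  by rewrite [RHS]addrACA [X in _ = _ + X]addrC.
- move=> s; rewrite mulrN mulNr -opprD jordanN mulrN mulNr -opprD; congr (- _).
  rewrite !mulrDr !mulrDl !mulrA X00 addrACA [X in _ + X]addrC jordanD jordan_triple.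
  by rewrite [RHS]addrACA X01 [X in _ = _ + X]addrC.
Qed.

(** By [trEmx] this is the congruence by [Emx (- t)], the two signs cancelling. *)
Lemma jordan_related_trEmx t X X' : jordan_related X X' ->
  jordan_related ((Emx t)^T *m X *m Emx t) ((Emx (alpha t))^T *m X' *m Emx (alpha t)).
Proof.
move/(jordan_related_Emx (- t)); rewrite jordanN !trEmx !opprK.
by rewrite !mulNmx !mulmxN.
Qed.

Lemma jordan_related_EmxS T X X' : jordan_related X X' ->
  jordan_related (EmxS T *m X *m trEmxS T)
                 (EmxS (map alpha T) *m X' *m trEmxS (map alpha T)).
Proof.
elim: T => [|t T IH] XX'; first by rewrite /= !mul1mx !mulmx1.
by have := jordan_related_Emx t (IH XX'); rewrite /= !mulmxA.
Qed.

Lemma jordan_related_trEmxS T X X' : jordan_related X X' ->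
  jordan_related (trEmxS T *m X *m EmxS T)
                 (trEmxS (map alpha T) *m X' *m EmxS (map alpha T)).
Proof.
move=> XX'; elim/last_ind: T => [|T t IH]; first by rewrite /= !mul1mx !mulmx1.
have := jordan_related_trEmx t IH.
by rewrite map_rcons !trEmxS_rcons -!cats1 !EmxS_cat /= !mulmx1 !mulmxA.
Qed.

Lemma jordan_fixes_pt10 T : fixes_pt10 (EmxS T) -> fixes_pt10 (EmxS (map alpha T)).
Proof.
move=> [b0 [y ya]]; set E := EmxS T in b0 ya; set E' := EmxS (map alpha T).
have fd : trEmxS T 0 0 * E 1 1 = 1.
  have /matrixP/(_ 0 1) := trEmxS_symplectic T.
  by rewrite !mulmx2E !EmxE -/E b0 !(mulr0, mulr1, mul0r, add0r, addr0).
pose p := E 1 1 * y.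
have fpa' : trEmxS (map alpha T) 0 0 * alpha p * E' 0 0 = 1.
  (* With this X, the (0,0) entry of E(T)^* X E(T) is f p a. *)
  have : jordan_related (p *: delta_mx 0 0) (alpha p *: delta_mx 0 0).
    by split=> [||s|s]; rewrite !mxE /= ?(mulr1, mulr0, mul0r, addr0, jordan0).
  move/(jordan_related_trEmxS T); case=> + _ _ _.
  rewrite !mulmx2E !mxE /= !(mulr0, mulr1, mul0r, add0r, addr0) => ->.
  by rewrite -/E /p mulrA fd mul1r ya jordan1.
have bf' : E' 0 1 * trEmxS (map alpha T) 0 0 = 0.
  (* With this X, the (0,0) entry of E(T) X E(T)^* is b f. *)
  have : jordan_related (delta_mx 1 0) (delta_mx 1 0).
    by split=> [||s|s]; rewrite !mxE /= ?(mulr1, mulr0, mul0r, mul1r, add0r, addr0, jordan0).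
  move/(jordan_related_EmxS T); case=> + _ _ _.
  rewrite !mulmx2E !mxE /= !(mulr0, mulr1, mul0r, add0r, addr0) => ->.
  by rewrite -/E b0 mul0r jordan0.
split; last by eexists; exact: fpa'.
(* b' = b' (f' p' a') = (b' f') p' a' = 0. *)
have fd' : trEmxS (map alpha T) 0 0 * (alpha p * E' 0 0) = 1 by rewrite mulrA.
by rewrite -[LHS]mulr1 -fd' mulrA bf' mul0r.
Qed.

(** E(T1) E(T2)^-1 is the word [T1 ++ Einv_word T2], which reduces the claim to the stabilizer of
    R(1,0). *)
Lemma jordan_pt10_eq T1 T2 :
  peq (pact (@pt10 R) (EmxS T1)) (pact (@pt10 R) (EmxS T2)) ->
  peq (pact (@pt10 R') (EmxS (map alpha T1))) (pact (@pt10 R') (EmxS (map alpha T2))).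
Proof.
move/(pact_pt10_eqP _ (EmxS_mulVl T2) (EmxS_mulV T2)).
rewrite -EmxS_cat => /jordan_fixes_pt10; rewrite map_cat -jordan_inv_word EmxS_cat.
by move/(pact_pt10_eqP _ (EmxS_mulVl _) (EmxS_mulV _)).
Qed.

(** * Central words and the subring R'' *)

Lemma gen_subring_map T t : t \in map alpha T -> gen_subring alpha t.
Proof. by case/mapP=> s _ -> P _; apply. Qed.

Lemma gen_subring_commute z :
  (forall a, z * alpha a = alpha a * z) -> forall x, gen_subring alpha x -> z * x = x * z.
Proof.
move=> cz x /(_ (fun x => z * x = x * z)); apply=> //; split; first by rewrite mulr1 mul1r.
split=> u v cu cv; first by rewrite mulrBr mulrBl cu cv.
by rewrite mulrA cu -mulrA cv mulrA.
Qed.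

Lemma jordan_centre T :
  E2centre (fun _ : R => True) (EmxS T) ->
  E2centre (gen_subring alpha) (EmxS (map alpha T)).
Proof.
move=> [_ cT]; set h := EmxS T in cT.
have fix_h : fixes_pt10 h.
  have b0 : h 0 1 = 0.
    (* Commuting with E(0) gives a = d, and with E(1) gives a = b + d. *)
    have /matrixP c0 := cT _ (E2_gen (S := fun _ => True) (t := 0) I).
    have /matrixP c1 := cT _ (E2_gen (S := fun _ => True) (t := 1) I).
    move: (c0 0 1) (c1 0 1); rewrite !mulmx2E !EmxE !(mulr0, mul0r, mulr1, mul1r, addr0, add0r).
    by move=> -> /eqP; rewrite -subr_eq0 opprD addrCA subrr addr0 oppr_eq0 => /eqP.
  split=> //; exists (EmxS (Einv_word T) 0 0).
  have c0 : h 1 0 = 0.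
    have /matrixP/(_ 0 0) := cT _ (E2_gen (S := fun _ => True) (t := 0) I).
    rewrite !mulmx2E !EmxE b0 !(mulr0, mul0r, mulr1, mul1r, addr0, add0r).
    by move=> <-.
  have /matrixP/(_ 0 0) := EmxS_mulVl T.
  by rewrite mulmx2E -/h c0 mulr0 addr0 mx1E.
set g := EmxS (map alpha T).
have conj t : alpha t * g 0 0 + g 1 0 = (alpha t * g 0 1 + g 1 1) * alpha t.
  (* This word is E(t) h E(t)^-1 = h. The relation says that the (0,1) entry of its image
     vanishes. *)
  have : fixes_pt10 (EmxS ([:: t] ++ T ++ [:: 0; - t; 0])).
    rewrite !EmxS_cat -/h cT; last exact: E2_EmxS.
    by rewrite mulmxA [EmxS [:: t]]/= mulmx1 Emx_mulV mul1mx.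
  move/jordan_fixes_pt10 => [+ _].
  rewrite !map_cat !EmxS_cat [map alpha [:: t]]/= [map alpha [:: 0; _; _]]/= jordan0 jordanN.
  rewrite [EmxS [:: alpha t]]/= mulmx1 -/g mulmx2E ![(g *m _) _ _]mulmx2E
    !EmxS_inv1 !EmxE !mul1r !mulrN1.
  rewrite !mulrDr !mulrN addrACA -opprD => /eqP; rewrite addrC subr_eq0 => /eqP <-.
  by rewrite mulrDl mulrA.
have [b0 _] := jordan_fixes_pt10 fix_h; rewrite -/g in b0.
have {}conj t : alpha t * g 0 0 + g 1 0 = g 1 1 * alpha t.
  by rewrite conj b0 mulr0 add0r.
(* t = 0 gives c' = 0, then t = 1 gives a' = d'; for general t, a' commutes with R^alpha and hence
   with R''. *)
have c0 : g 1 0 = 0 by have := conj 0; rewrite jordan0 mul0r mulr0 add0r.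
have ad : g 0 0 = g 1 1 by have := conj 1; rewrite jordan1 mul1r mulr1 c0 addr0.
split; first by apply: E2_EmxS => t; apply: gen_subring_map.
apply: E2_commute => t St.
have ct : g 0 0 * t = t * g 0 0.
  by apply: gen_subring_commute St => a; rewrite {1}ad -conj c0 addr0.
apply: matrix2P; rewrite !mulmx2E !EmxE ?b0 ?c0 -?ad;
by rewrite !(mulr0, mul0r, mulr1, mul1r, addr0, add0r, mulrN, mulNr, oppr0) ?ct.
Qed.

End JordanHom.

Theorem theorem4p4 (R R' : pzRingType) (alpha : R -> R') :
  jordan_hom alpha ->
  let S'' := gen_subring alpha in
  let All := fun _ : R => True in
  (* (a) alpha_PE : H E(T) |-> H'' E(T^alpha) is a well-defined group homomorphism
         PE_2(R) -> PE_2(R'') *)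
  ((forall M, E2 All M -> exists T, M = EmxS T) /\
   (forall T, E2 S'' (EmxS (map alpha T))) /\
   (forall T1 T2, (exists h, E2centre All h /\ EmxS T1 = h *m EmxS T2) ->
      exists h'', E2centre S'' h'' /\
        EmxS (map alpha T1) = h'' *m EmxS (map alpha T2)) /\
   (forall T1 T2, exists h'', E2centre S'' h'' /\
      EmxS (map alpha (T1 ++ T2)) = h'' *m (EmxS (map alpha T1) *m EmxS (map alpha T2))))
  /\
  (* (b) alpha_bar : R(1,0) E(T) |-> R'(1',0') E(T^alpha) is a well-defined map C -> C'' *)
  ((forall p, inC All p -> exists T, peq p (pact (@pt10 R) (EmxS T))) /\
   (forall T, inC S'' (pact (@pt10 R') (EmxS (map alpha T)))) /\
   (forall T1 T2, peq (pact (@pt10 R) (EmxS T1)) (pact (@pt10 R) (EmxS T2)) ->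
      peq (pact (@pt10 R') (EmxS (map alpha T1))) (pact (@pt10 R') (EmxS (map alpha T2)))))
  /\
  (* (c) (p . E(T))^alpha_bar = p^alpha_bar . E(T^alpha) for p in C *)
  (forall S T U, peq (pact (@pt10 R) (EmxS U)) (pact (pact (@pt10 R) (EmxS S)) (EmxS T)) ->
     peq (pact (@pt10 R') (EmxS (map alpha U)))
         (pact (pact (@pt10 R') (EmxS (map alpha S))) (EmxS (map alpha T)))).
Proof.
move=> alphaJ S'' All.
have E2S T : E2 S'' (EmxS (map alpha T)).
  by apply: E2_EmxS => t; apply: gen_subring_map.
split; last split.
- split; first exact: E2_word.
  split=> //; split=> [T1 T2 [h [ch eqh]]|T1 T2].
    (* The central factor h is itself the word E(T1) E(T2)^-1, and its image serves as h''. *)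
    exists (EmxS (map alpha (T1 ++ Einv_word T2))); split.
      apply: jordan_centre => //.
      by rewrite EmxS_cat eqh -mulmxA EmxS_mulV mulmx1.
    by rewrite map_cat -jordan_inv_word // EmxS_cat -mulmxA EmxS_mulVl mulmx1.
  exists 1%:M; rewrite mul1mx map_cat EmxS_cat; split=> //.
  by split=> [|N _]; [exact: E2_one | rewrite mulmx1 mul1mx].
- split=> [p [g [/E2_word[T ->] eqp]]|]; first by exists T.
  split=> [T|]; first by exists (EmxS (map alpha T)).
  exact: jordan_pt10_eq.
- move=> S T U eqU w; apply: iff_trans (pact_comp _ _ _ w).
  (* Both actions are concatenations of words, so (c) is (b) for [U] and [S ++ T]. *)
  rewrite -EmxS_cat -map_cat; apply: (jordan_pt10_eq alphaJ) => v.
  by rewrite EmxS_cat; apply: iff_trans (eqU v) (iff_sym (pact_comp _ _ _ v)).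
Qed.
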